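(* Let $A_0,A_1,A_2\in\mathbb{C}^{n,n}$, let $P(\lambda)=\lambda^2A_2+\lambda A_1+A_0$ be a quadratic matrix polynomial and let $D$ be a nonempty open or closed subset of $\mathbb{C}$. If at least one of the following conditions holds: (a) the bivariate matrix polynomial $(z_1,z_2)\mapsto z_1^2A_2+z_2A_1+A_0$ is stable with respect to $D^2$; (b) the bivariate matrix polynomial $(z_1,z_2)\mapsto z_1z_2A_2+z_2A_1+A_0$ is stable with respect to $D^2$ and $0\notin D$; (c) the bivariate matrix polynomial $(z_1,z_2)\mapsto z_1^2z_2A_2+z_1^2A_1+z_2A_0$ is stable with respect to $D^2$ and $0\notin D$; then the matrix polynomial $\lambda\mapsto P(\lambda)$ is hyperstable with respect to $D$.
   Context: A bivariate matrix polynomial $Q(z_1,z_2)\in\mathbb{C}^{n,n}[z_1,z_2]$ is stable with respect to a nonempty set $\Omega\subseteq\mathbb{C}^2$ if for all $(w_1,w_2)\in \Omega$ and all $x\in\mathbb{C}^n\setminus\{0\}$ there exists $y\in\mathbb{C}^n\setminus\{0\}$ with $y^*Q(w_1,w_2)x\neq0$ (equivalently, $\det Q(w_1,w_2)\ne 0$ on $\Omega$). A univariate matrix polynomial $P(\lambda)\in\mathbb{C}^{n,n}[\lambda]$ is regular if $\det P(\lambda)\not\equiv0$. A regular $P(\lambda)$ is hyperstable with respect to a nonempty open or closed $D\subseteq\mathbb{C}$ if for every $x\in\mathbb{C}^n\setminus\{0\}$ there exists $y\in\mathbb{C}^n\setminus\{0\}$ such that $y^*P(\mu)x\neq0$ for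 all $\mu\in D$ (this condition forces regularity). *)

(* Defs.v *)
From mathcomp Require Import all_boot all_order all_algebra.
From mathcomp Require Import sesquilinear spectral polyXY.
From mathcomp Require Import classical_sets.

Set Implicit Arguments.
Unset Strict Implicit.
Unset Printing Implicit Defensive.

Import Order.TTheory GRing.Theory Num.Theory.
Local Open Scope ring_scope.
Local Open Scope sesquilinear_scope.

Section MatrixPolynomials.
Variables (C : numClosedFieldType) (n : nat).

(* Matrix polynomials are matrices with polynomial entries. In two variables,
   'X is z1 and 'Y is z2, so that p.[w1, w2] substitutes w1 for z1 and w2 for
   z2. *)
Definition mxpolyC (A : 'M[C]_n) : 'M[{poly C}]_n := map_mx polyC A.

Definition mxpolyCC (A : 'M[C]_n) : 'M[{poly {poly C}}]_n :=
  map_mx (fun a => a%:P%:P) A.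

Definition mxeval (P : 'M[{poly C}]_n) (mu : C) : 'M[C]_n :=
  map_mx (fun p => p.[mu]) P.

Definition mxeval2 (Q : 'M[{poly {poly C}}]_n) (w1 w2 : C) : 'M[C]_n :=
  map_mx (fun p => p.[w1, w2]) Q.

Definition stable (Q : 'M[{poly {poly C}}]_n) (Omega : set (C * C)) : Prop :=
  forall w1 w2 : C, Omega (w1, w2) ->
  forall x : 'cV[C]_n, x != 0 ->
  exists2 y : 'cV[C]_n, y != 0 & y^t* *m mxeval2 Q w1 w2 *m x != 0.

Definition regular (P : 'M[{poly C}]_n) : Prop := \det P != 0.

Definition hyperstable (P : 'M[{poly C}]_n) (D : set C) : Prop :=
  regular P /\
  forall x : 'cV[C]_n, x != 0 ->
  exists2 y : 'cV[C]_n, y != 0 &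
    forall mu : C, D mu -> y^t* *m mxeval P mu *m x != 0.

End MatrixPolynomials.

(* Main.v *)
Require Import Defs.
From mathcomp Require Import all_boot all_order all_algebra.
From mathcomp Require Import polyXY complex.
From mathcomp Require Import classical_sets reals topology normedtype.
From mathcomp Require Import boolp sesquilinear spectral ring.

(* Fix x and put v_i = A_i x: we look for a linear functional y such that
   mu^2 y(v2) + mu y(v1) + y(v0) has no root in D. If one distinguished v_i is
   independent of the other two, take y supported on it. Otherwise P(mu) x is a
   combination g1(mu) u1 + g2(mu) u2 of the other two vectors, which stability
   on the diagonal keeps nonzero on D; when u1, u2 are dependent any functional
   not killing them works, and when they are independent y(u1), y(u2) are
   free: stability off the diagonal says exactly that g1, g2 or a suitable
   combination of them has no root in D. *)

Import Order.TTheory GRing.Theory Num.Theory.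
Import numFieldNormedType.Exports.
Local Open Scope classical_set_scope.
Local Open Scope ring_scope.
Local Open Scope complex_scope.
Local Open Scope sesquilinear_scope.

Section Functionals.
Set Implicit Arguments.
Unset Strict Implicit.
Variables (F : fieldType) (n : nat).
Implicit Types (u v : 'cV[F]_n) (y : 'rV[F]_n).

(** If [v^T] is not in the row space of [U^T], some column of the cokernel of [U^T] pairs
    nontrivially with [v] while annihilating [U]; rescaling it gives [y]. *)
Lemma colspan_or_functional m (U : 'M[F]_(n, m)) v :
  (exists a, v = U *m a) \/
  (exists2 y : 'rV[F]_n, y *m U = 0 & y *m v = 1%:M).
Proof.
case: (boolP (v^T <= U^T)%MS) => [/submxP[a vE]|].
  by left; exists a^T; rewrite -[v]trmxK vE trmx_mul trmxK.
rewrite submxE; have := mulmx_coker U^T; move: (cokermx _) => k Uk0.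
move=> /matrix0Pn[i [j cNE0]]; right.
have colK p (w : 'M_(n, p)) : (col j k)^T *m w = (col j (w^T *m k))^T.
  by rewrite !colE -mulmxA (trmx_mul w^T) trmxK.
exists (((v^T *m k) i j)^-1 *: (col j k)^T); rewrite -scalemxAl colK.
  by rewrite Uk0 col0 trmx0 scaler0.
move: (v^T *m k) cNE0 => c; rewrite (ord1 i) => cNE0.
by apply/matrixP => a b; rewrite !mxE !ord1 eqxx mulVf.
Qed.

(** For independent [u1], [u2], dual functionals allow [y] to take the values [t1], [t2] there.
    Otherwise the combination is a scalar times one vector, and any [y] equal to 1 on that vector
    works. *)
Lemma functional_comb (T : Type) (D : set T) (g1 g2 : T -> F) (t1 t2 : F) u1 u2 :
  D !=set0 ->
  (forall mu, D mu -> g1 mu *: u1 + g2 mu *: u2 != 0) ->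
  (forall mu, D mu -> g1 mu * t1 + g2 mu * t2 != 0) ->
  exists y, forall mu, D mu -> y *m (g1 mu *: u1 + g2 mu *: u2) != 0.
Proof.
have aux w1 w2 (h1 h2 : T -> F) (a : 'M_1) : w1 = w2 *m a -> D !=set0 ->
    (forall mu, D mu -> h1 mu *: w1 + h2 mu *: w2 != 0) ->
    exists y, forall mu, D mu -> y *m (h1 mu *: w1 + h2 mu *: w2) != 0.
  rewrite [a]mx11_scalar mul_mx_scalar => -> [d Dd].
  set c := a 0 0 => hN0.
  have hE mu : h1 mu *: (c *: w2) + h2 mu *: w2 = (h1 mu * c + h2 mu) *: w2.
    by rewrite scalerDl scalerA.
  (* With a zero matrix the first alternative reads [w2 = 0], which is excluded at the point [d]. *)
  have [[b w2E]|[y _ yw2]] := colspan_or_functional (0 : 'M_(n, 1)) w2.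
    by move: (hN0 d Dd); rewrite w2E mul0mx !scaler0 addr0 eqxx.
  exists y => mu Dmu; have := hN0 mu Dmu.
  by rewrite hE -scalemxAr yw2 scaler_eq0 negb_or scaler_eq0 oner_eq0 orbF => /andP[].
move=> D0 hN0 tN0.
have [[a u1E]|[y1 y1u2 y1u1]] := colspan_or_functional u2 u1.
  exact: aux u1E D0 hN0.
have [[a u2E]|[y2 y2u1 y2u2]] := colspan_or_functional u1 u2.
  have [mu Dmu|y yP] := aux _ _ g2 g1 a u2E D0; first by rewrite addrC hN0.
  by exists y => mu Dmu; rewrite addrC yP.
exists (t1 *: y1 + t2 *: y2) => mu Dmu.
rewrite mulmxDl !mulmxDr -!scalemxAl -!scalemxAr y1u1 y1u2 y2u1 y2u2.
rewrite !scaler0 addr0 add0r !scalerA -scalerDl scaler_eq0 oner_eq0 orbF.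
by rewrite mulrC [t2 * _]mulrC tN0.
Qed.

(** The minus sign makes substituting for [v] produce coefficients that are differences, such as
    [mu - a1], whose roots can be read off. *)
Lemma span2_or_functional u1 u2 v :
  (exists a1 a2, v = - (a1 *: u1 + a2 *: u2)) \/
  (exists y, [/\ y *m u1 = 0, y *m u2 = 0 & y *m v = 1%:M]).
Proof.
have [[a ->]|[y]] := colspan_or_functional (row_mx u1 u2) v.
  left; exists (- usubmx a 0 0), (- dsubmx a 0 0).
  rewrite -[a in LHS]vsubmxK mul_row_col !scaleNr -opprD opprK.
  rewrite [usubmx a in LHS]mx11_scalar [dsubmx a in LHS]mx11_scalar.
  by rewrite !mul_mx_scalar.
rewrite mul_mx_row -row_mx0 => /eq_row_mx[yu1 yu2] yv.
by right; exists y.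
Qed.

Variables (D : set F) (v2 v1 v0 : 'cV[F]_n).
Hypothesis D_neq0 : D !=set0.

Let quad (mu : F) := mu ^+ 2 *: v2 + mu *: v1 + v0.

(** Common core of (a) and (b): [h] is the coefficient of [v2], equal to [w1 ^+ 2] or [w1 * w2], and
    [v0] is the distinguished vector. *)
Lemma functional_quad (h : F -> F -> F) :
  (forall mu, h mu mu = mu ^+ 2) ->
  (forall w1 w2, D w1 -> D w2 -> h w1 w2 *: v2 + w2 *: v1 + v0 != 0) ->
  (forall a2 a1, D a1 -> (forall w, D w -> h w a1 != a2) ->
     exists t2 t1, forall mu, D mu ->
       (mu ^+ 2 - a2) * t2 + (mu - a1) * t1 != 0) ->
  exists y, forall mu, D mu -> y *m quad mu != 0.
Proof.
move=> hE st tP.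
have [[a2 [a1 v0E]]|[y [y2 y1 y0]]] := span2_or_functional v2 v1 v0; last first.
  exists y => mu _; rewrite /quad !mulmxDr -!scalemxAr y2 y1 y0 !scaler0 !add0r.
  exact: oner_neq0.
have E c w2 : c *: v2 + w2 *: v1 + v0 = (c - a2) *: v2 + (w2 - a1) *: v1.
  by rewrite v0E opprD addrACA -!scalerBl.
have N0 mu : D mu -> (mu ^+ 2 - a2) *: v2 + (mu - a1) *: v1 != 0.
  by move=> Dmu; rewrite -E -hE st.
suff [t2 [t1 t12P]] : exists t2 t1 : F, forall mu, D mu ->
    (mu ^+ 2 - a2) * t2 + (mu - a1) * t1 != 0.
  have [y yP] := functional_comb D_neq0 N0 t12P.
  by exists y => mu Dmu; rewrite /quad E yP.
(* If [a1] lies in [D], setting [w2 = a1] kills the [v1] term, so stability forces [h w a1 != a2].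
   If not, [mu - a1] has no root in [D]. *)
have [Da1|nDa1] := pselect (D a1).
  apply: tP => // w Dw; apply: contra_neq (st w a1 Dw Da1) => ha2.
  by rewrite E ha2 !subrr !scale0r addr0.
exists 0, 1 => mu Dmu; rewrite mulr1 mulr0 add0r subr_eq0.
by apply/eqP => muE; apply: nDa1; rewrite -muE.
Qed.

Lemma functional_quad_a :
  (forall w1 w2, D w1 -> D w2 -> w1 ^+ 2 *: v2 + w2 *: v1 + v0 != 0) ->
  exists y, forall mu, D mu -> y *m quad mu != 0.
Proof.
move=> st; apply: (@functional_quad (fun w1 _ => w1 ^+ 2)) => // a2 a1 Da1 ha2.
by exists 1, 0 => mu Dmu; rewrite mulr1 mulr0 addr0 subr_eq0 ha2.
Qed.

Lemma functional_quad_b : ~ D 0 ->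
  (forall w1 w2, D w1 -> D w2 -> (w1 * w2) *: v2 + w2 *: v1 + v0 != 0) ->
  exists y, forall mu, D mu -> y *m quad mu != 0.
Proof.
move=> D0 st; apply: (@functional_quad *%R) => // a2 a1 Da1 ha2.
have DN0 mu : D mu -> mu != 0 by move=> Dmu; apply/eqP => mu0; rewrite mu0 in Dmu.
(* The weight [- (a2 / a1)] cancels the constant term, leaving the roots 0 and [a2 / a1]; the latter
   is outside [D] since [w * a1 != a2] on [D]. *)
have a1N0 := DN0 _ Da1; exists 1, (- (a2 / a1)) => mu Dmu.
have -> : (mu ^+ 2 - a2) * 1 + (mu - a1) * - (a2 / a1) = mu * (mu - a2 / a1).
  by field.
rewrite mulf_neq0 ?(DN0 mu) //; apply: contra_neq (ha2 mu Dmu) => /subr0_eq ->.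
by rewrite divfK.
Qed.

Lemma functional_quad_c : ~ D 0 ->
  (forall w1 w2, D w1 -> D w2 ->
     (w1 ^+ 2 * w2) *: v2 + w1 ^+ 2 *: v1 + w2 *: v0 != 0) ->
  exists y, forall mu, D mu -> y *m quad mu != 0.
Proof.
move=> D0 st.
have DN0 mu : D mu -> mu != 0 by move=> Dmu; apply/eqP => mu0; rewrite mu0 in Dmu.
have [[a1 [a0 v2E]]|[y [y1 y0 y2]]] := span2_or_functional v1 v0 v2; last first.
  exists y => mu Dmu; rewrite /quad !mulmxDr -!scalemxAr y2 y1 y0 !scaler0 !addr0.
  by rewrite scaler_eq0 oner_eq0 orbF expf_neq0 ?DN0.
have E c2 c1 c0 : c2 *: v2 + c1 *: v1 + c0 *: v0
                = (c1 - c2 * a1) *: v1 + (c0 - c2 * a0) *: v0.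
  rewrite v2E scalerN scalerDr !scalerA opprD.
  by rewrite -addrA addrC addrACA -!scalerBl.
have quadE mu : quad mu = (mu - mu ^+ 2 * a1) *: v1 + (1 - mu ^+ 2 * a0) *: v0.
  by rewrite -E scale1r.
have N0 mu : D mu -> (mu - mu ^+ 2 * a1) *: v1 + (1 - mu ^+ 2 * a0) *: v0 != 0.
  (* On the diagonal the bivariate form equals [mu *: quad mu]. *)
  move=> Dmu; rewrite -quadE; apply: contra_neq (st mu mu Dmu Dmu) => q0.
  rewrite -[RHS](scaler0 _ mu) -q0 /quad !scalerDr !scalerA.
  by rewrite -expr2 -exprS -exprSr.
suff [t1 [t0 tP]] : exists t1 t0 : F, forall mu, D mu ->
    (mu - mu ^+ 2 * a1) * t1 + (1 - mu ^+ 2 * a0) * t0 != 0.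
  have [y yP] := functional_comb D_neq0 N0 tP.
  by exists y => mu Dmu; rewrite quadE yP.
(* The [v1] coefficient is [mu * (1 - mu * a1)], with possible roots 0 and [a1^-1]. If [a1 = 0],
   then [a1^-1 = 0] by convention, which is outside [D]. *)
have [Da1|nDa1] := pselect (D a1^-1); last first.
  exists 1, 0 => mu Dmu; rewrite mulr1 mulr0 addr0.
  rewrite (_ : mu - _ = mu * (1 - mu * a1)); last by ring.
  rewrite mulf_neq0 ?(DN0 mu) //; apply/eqP => /subr0_eq eq1; apply: nDa1.
  have a1N0 : a1 != 0.
    by apply/eqP => a10; move/eqP: eq1; rewrite a10 mulr0 oner_eq0.
  by rewrite -[a1^-1]mul1r eq1 mulfK.
have a1N0 : a1 != 0 by rewrite -invr_eq0 DN0.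
(* At [w2 = a1^-1] the [v1] term vanishes and the [v0] coefficient is [a1^-1 * (1 - mu ^+ 2 * a0)],
   so stability makes the second factor nonzero. *)
exists 0, 1 => mu Dmu; rewrite mulr1 mulr0 add0r.
apply: contra_neq (st mu a1^-1 Dmu Da1) => eq0.
rewrite E mulfVK // subrr scale0r add0r.
rewrite (_ : _ - _ = a1^-1 * (1 - mu ^+ 2 * a0)); last by ring.
by rewrite eq0 mulr0 scale0r.
Qed.

End Functionals.

Section Evaluation.
Set Implicit Arguments.
Unset Strict Implicit.
Variables (C : numClosedFieldType) (n : nat).

Lemma mxeval2D (P Q : 'M[{poly {poly C}}]_n) w1 w2 :
  mxeval2 (P + Q) w1 w2 = mxeval2 P w1 w2 + mxeval2 Q w1 w2.
Proof. by apply/matrixP => i j; rewrite !mxE !hornerE. Qed.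

Lemma mxeval2Z (p : {poly {poly C}}) (A : 'M[C]_n) w1 w2 :
  mxeval2 (p *: mxpolyCC A) w1 w2 = p.[w1, w2] *: A.
Proof. by apply/matrixP => i j; rewrite !mxE !hornerE. Qed.

Lemma mxeval2C (A : 'M[C]_n) w1 w2 : mxeval2 (mxpolyCC A) w1 w2 = A.
Proof. by apply/matrixP => i j; rewrite !mxE !hornerE. Qed.

Lemma mxeval_quad (A0 A1 A2 : 'M[C]_n) mu :
  mxeval ('X^2 *: mxpolyC A2 + 'X *: mxpolyC A1 + mxpolyC A0) mu
  = mu ^+ 2 *: A2 + mu *: A1 + A0.
Proof. by apply/matrixP => i j; rewrite !mxE !hornerE. Qed.

Lemma stable_mul_neq0 (Q : 'M[{poly {poly C}}]_n) Omega w1 w2 (x : 'cV[C]_n) :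
  stable Q Omega -> Omega (w1, w2) -> x != 0 -> mxeval2 Q w1 w2 *m x != 0.
Proof.
move=> st Ow x0; have [y _] := st w1 w2 Ow x x0.
by apply: contra_neq; rewrite -mulmxA => ->; rewrite mulmx0.
Qed.

Lemma det_mxeval (P : 'M[{poly C}]_n) mu : (\det P).[mu] = \det (mxeval P mu).
Proof. exact: (esym (det_map_mx (horner_eval mu) P)). Qed.

(** Regularity comes for free: if the determinant vanished at a point [d] of [D], a kernel vector of
    [mxeval P d] would defeat every [y]. Nonvanishing at [d] also gives [y != 0]. *)
Lemma hyperstableP (P : 'M[{poly C}]_n) (D : set C) : D !=set0 ->
  (forall x : 'cV[C]_n, x != 0 -> exists y : 'rV[C]_n,
     forall mu, D mu -> y *m (mxeval P mu *m x) != 0) ->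
  hyperstable P D.
Proof.
move=> [d Dd] hP; split=> [|x /hP[y yP]].
  rewrite /regular; apply/eqP => detP0; have := det_mxeval P d.
  rewrite detP0 horner0 -det_tr => /esym/eqP/det0P[v v0 vP].
  have /hP[y /(_ d Dd)] : v^T != 0 by rewrite trmx_eq0.
  by rewrite -[mxeval P d]trmxK -trmx_mul vP trmx0 mulmx0 eqxx.
exists (y^t*) => [|mu Dmu]; last by rewrite trmxCK -mulmxA yP.
apply: contra_neq (yP d Dd) => y0; rewrite -[y]trmxCK y0.
by rewrite trmx0 map_mx0 mul0mx.
Qed.

End Evaluation.

(* The alias R[i]^o carries the topology of the modulus on R[i]. *)
Theorem theorem5p1 (R : realType) (n : nat) (A0 A1 A2 : 'M[R[i]]_n)
    (D : set R[i]) (D_neq0 : D !=set0)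
    (D_open_or_closed : open (D : set R[i]^o) \/ closed (D : set R[i]^o)) :
  [\/ stable ('X^2 *: mxpolyCC A2 + 'Y *: mxpolyCC A1 + mxpolyCC A0) (D `*` D),
      stable (('X * 'Y) *: mxpolyCC A2 + 'Y *: mxpolyCC A1 + mxpolyCC A0)
        (D `*` D) /\ ~ D 0
    | stable (('X^2 * 'Y) *: mxpolyCC A2 + 'X^2 *: mxpolyCC A1
              + 'Y *: mxpolyCC A0) (D `*` D) /\ ~ D 0] ->
  hyperstable ('X^2 *: mxpolyC A2 + 'X *: mxpolyC A1 + mxpolyC A0) D.
Proof.
move=> st; apply: hyperstableP => // x x0.
suff [y yP] : exists y : 'rV[R[i]]_n, forall mu, D mu ->
    y *m (mu ^+ 2 *: (A2 *m x) + mu *: (A1 *m x) + A0 *m x) != 0.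
  exists y => mu Dmu.
  by rewrite mxeval_quad !mulmxDl -!scalemxAl yP.
case: st => [st|[st D0]|[st D0]].
- apply: functional_quad_a => // w1 w2 Dw1 Dw2.
  have := stable_mul_neq0 st (conj Dw1 Dw2) x0.
  by rewrite !mxeval2D !mxeval2Z mxeval2C !mulmxDl -!scalemxAl !hornerE.
- apply: functional_quad_b => // w1 w2 Dw1 Dw2.
  have := stable_mul_neq0 st (conj Dw1 Dw2) x0.
  by rewrite !mxeval2D !mxeval2Z mxeval2C !mulmxDl -!scalemxAl !hornerE.
- apply: functional_quad_c => // w1 w2 Dw1 Dw2.
  have := stable_mul_neq0 st (conj Dw1 Dw2) x0.
  by rewrite !mxeval2D !mxeval2Z !mulmxDl -!scalemxAl !hornerE.
Qed.
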